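(* Let $n\geq 1$ be an integer, $\varrho>0$ real, and $f\in C[0,1]$. Let $\Phi_n\in\Pi_n$ be the polynomial with $\Phi_n\left(\frac kn\right)=F_{n,k}^{\varrho}(f)$ for $k=0,\dots,n$. Then for all $x\in[0,1]$: (i) $\displaystyle (U_n^{\varrho}(f;x))'=n\sum_{k=0}^{n-1}p_{n-1,k}(x)\,\Delta^1F_{n,k}^{\varrho}(f)=\sum_{k=0}^{n-1}p_{n-1,k}(x)\left[\frac kn,\frac{k+1}{n};\Phi_n\right]$; (ii) for every integer $j$ with $0\leq j\leq n$, $$(U_n^{\varrho}(f;x))^{(j)}=n(n-1)\cdots(n-j+1)\sum_{k=0}^{n-j}p_{n-j,k}(x)\,\Delta^jF_{n,k}^{\varrho}(f)$$ $$=n(n-1)\cdots(n-j+1)\sum_{k=0}^{n-j}p_{n-j,k}(x)\,\frac{j!}{n^j}\left[\frac kn,\dots,\frac{k+j}{n};\Phi_n\right];$$ (iii) $\displaystyle U_n^{\varrho}(f;x)=\sum_{k=0}^n\binom nk\Delta^kF_{n,0}^{\varrho}(f)\,e_k(x)=\sum_{k=0}^n\binom nk\frac{k!}{n^k}\left[0,\frac1n,\dots,\frac kn;\Phi_n\right]e_k(x)$.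
   Context: $\Pi_n$ denotes the space of real polynomials of degree at most $n$, $B(\cdot,\cdot)$ is the Euler Beta function, $e_j(x)=x^j$, and $p_{m,k}(x)=\binom mk x^k(1-x)^{m-k}$. For real $\varrho>0$ and an integer $n\geq 1$, define functionals $F_{n,k}^{\varrho}:C[0,1]\to\mathbb{R}$, $k=0,\dots,n$, by $$F_{n,0}^{\varrho}(f)=f(0),\quad F_{n,n}^{\varrho}(f)=f(1),\quad F_{n,k}^{\varrho}(f)=\int_0^1\frac{t^{k\varrho-1}(1-t)^{(n-k)\varrho-1}}{B(k\varrho,(n-k)\varrho)}f(t)\,dt,\ 1\leq k\leq n-1.$$ The operator $U_n^{\varrho}:C[0,1]\to\Pi_n$ is $U_n^{\varrho}(f;x)=\sum_{k=0}^n F_{n,k}^{\varrho}(f)\,p_{n,k}(x)$, $x\in[0,1]$. The forward differences are $\Delta^jF_{n,k}^{\varrho}(f)=\sum_{i=0}^j\binom ji(-1)^{i+j}F_{n,k+i}^{\varrho}(f)$ for $0\le k\le n-j$. $[x_0,\dots,x_j;g]$ denotes the classical divided difference of $g$ at the distinct nodes $x_0,\dots,x_j$ (with $[x_0;g]=g(x_0)$). The superscript $(j)$ denotes the $j$-th derivative with respect to $x$; for $j=0$ the product $n(n-1)\cdots(n-j+1)$ is empty and equals $1$. *)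

(* Defs.v *)
From mathcomp Require Import all_boot all_order all_algebra.
From mathcomp Require Import all_classical all_reals all_analysis.

Set Implicit Arguments.
Unset Strict Implicit.
Unset Printing Implicit Defensive.

Import Order.TTheory GRing.Theory Num.Theory.
Import numFieldNormedType.Exports.

Local Open Scope classical_set_scope.
Local Open Scope ring_scope.

(* [beta_fun] of MathComp-Analysis only takes natural-number parameters.
   For 0 < a < 1 the integrand is unbounded near 0 (likewise b near 1), hence
   the Lebesgue integral; its values at the endpoints are irrelevant. *)
Definition euler_beta (R : realType) (a b : R) : R :=
  \int[@lebesgue_measure R]_(t in `[0, 1])
    (t `^ (a - 1) * (1 - t) `^ (b - 1)).

Definition bernstein (R : realType) (m k : nat) : {poly R} :=
  'C(m, k)%:R *: ('X^k * (1 - 'X) ^+ (m - k)).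

Definition F_fun (R : realType) (n : nat) (rho : R) (k : nat) (f : R -> R) : R :=
  if k == 0%N then f 0
  else if k == n then f 1
  else \int[@lebesgue_measure R]_(t in `[0, 1])
         (t `^ (k%:R * rho - 1) * (1 - t) `^ ((n - k)%:R * rho - 1)
            / euler_beta (k%:R * rho) ((n - k)%:R * rho) * f t).

(* The operator lands in the polynomials; [(U_op n rho f).[x]] is its value
   at x, and derivatives at 0 and 1 are those of this polynomial. *)
Definition U_op (R : realType) (n : nat) (rho : R) (f : R -> R) : {poly R} :=
  \sum_(k < n.+1) F_fun n rho k f *: bernstein R n k.

Definition fwd_diff (R : realType) (n : nat) (rho : R) (j k : nat)
    (f : R -> R) : R :=
  \sum_(i < j.+1) 'C(j, i)%:R * (-1) ^+ (i + j) * F_fun n rho (k + i) f.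

(* [divided_diff g j x] is [x_0, ..., x_j; g]: only the first j + 1 terms of
   the node sequence x are used, and they are meant to be distinct. *)
Fixpoint divided_diff (R : realType) (g : R -> R) (j : nat) (x : nat -> R) : R :=
  if j is j'.+1 then
    (divided_diff g j' (fun i => x i.+1) - divided_diff g j' x) / (x j - x 0%N)
  else g (x 0%N).

Definition nodes (R : realType) (n k : nat) : nat -> R :=
  fun i => (k + i)%:R / n%:R.

(* Main.v *)
(* Only the sequence a_k = F_{n,k}(f) matters.  Differentiating a polynomial in
   Bernstein form replaces its coefficients by their forward differences, up to
   the degree; this gives the derivative formulas.  At 0 only the first
   Bernstein polynomial does not vanish, so the j-th derivative at 0, divided by
   j!, yields the coefficient of x^j.  Finally a divided difference at
   equispaced nodes is a rescaled forward difference. *)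
Require Import Defs.
From mathcomp Require Import all_boot all_order all_algebra.
From mathcomp Require Import all_classical all_reals all_analysis.
From mathcomp Require Import ring.

Set Implicit Arguments.
Unset Strict Implicit.
Unset Printing Implicit Defensive.

Import Order.TTheory GRing.Theory Num.Theory.
Import numFieldNormedType.Exports.

Local Open Scope classical_set_scope.
Local Open Scope ring_scope.

Definition fdiff (R : realType) (a : nat -> R) (j k : nat) : R :=
  \sum_(i < j.+1) 'C(j, i)%:R * (-1) ^+ (i + j) * a (k + i)%N.

Definition bernstein_form (R : realType) (m : nat) (a : nat -> R) : {poly R} :=
  \sum_(k < m.+1) a k *: bernstein R m k.

Lemma fdiff0 (R : realType) (a : nat -> R) (k : nat) : fdiff a 0 k = a k.
Proof. by rewrite /fdiff big_ord1 bin0 expr0 !mul1r addn0. Qed.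

Lemma fdiffS (R : realType) (a : nat -> R) (j k : nat) :
  fdiff a j.+1 k = fdiff a j k.+1 - fdiff a j k.
Proof.
rewrite /fdiff big_ord_recl /= big_ord_recr /=.
rewrite [X in X - _]big_ord_recr /= [X in _ - X]big_ord_recl /=.
set S1 := \sum_(i < j) _; set S2 := \sum_(i < j) _; set S3 := \sum_(i < j) _.
(* With the extreme terms split off, all three sums run over the same values [a (k + i + 1)], and
   Pascal's rule matches their coefficients. *)
have -> : S1 = S2 - S3.
  rewrite /S1 /S2 /S3 -sumrB; apply: eq_bigr => i _.
  rewrite /bump /= !add1n binS natrD !addSn !addnS !exprS; ring.
rewrite /bump /= !add1n !binn !bin0 !addSn !addnS !add0n !exprS; ring.
Qed.

Lemma bernstein_gt (R : realType) (m k : nat) :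
  (m < k)%N -> bernstein R m k = 0.
Proof. by move=> ltmk; rewrite /bernstein bin_small // scale0r. Qed.

Lemma deriv_bernstein0 (R : realType) (m : nat) :
  deriv (bernstein R m.+1 0) = - (m.+1%:R *: bernstein R m 0).
Proof.
rewrite /bernstein !bin0 !scale1r !expr0 !mul1r !subn0.
rewrite deriv_exp derivB derivX -polyC1 derivC sub0r /= polyC1 mulN1r mulNrn.
by rewrite scaler_nat.
Qed.

(** The two terms of the product rule are absorbed by (k+1) C(m+1,k+1) = (m+1) C(m,k) and (m-k)
    C(m+1,k+1) = (m+1) C(m,k+1). *)
Lemma deriv_bernsteinS (R : realType) (m k : nat) :
  deriv (bernstein R m.+1 k.+1)
  = m.+1%:R *: (bernstein R m k - bernstein R m k.+1).
Proof.
rewrite /bernstein derivZ derivM derivXn deriv_exp derivB derivX -polyC1 derivC.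
rewrite sub0r /= polyC1 subSS -subnS scalerBr !scalerA -!natrM.
rewrite (mul_bin_diag m.+1 k) (mul_bin_down m.+1 k.+1) subSS scalerDr.
rewrite mulrnAl mulN1r mulNrn mulrN mulrnAr scalerN -!scalerMnr.
by rewrite !scalerMnl -!mulrnA !(mulnC 'C(_, _)).
Qed.

(** Summation by parts: each [bernstein R m k] is reached from the indices k and k+1 of degree m+1,
    with opposite signs. *)
Lemma deriv_bernstein_form (R : realType) (m : nat) (a : nat -> R) :
  deriv (bernstein_form m.+1 a)
  = m.+1%:R *: bernstein_form m (fun k => a k.+1 - a k).
Proof.
rewrite /bernstein_form raddf_sum /= big_ord_recl /= derivZ deriv_bernstein0.
under eq_bigr => i _ do rewrite derivZ deriv_bernsteinS /bump /= add1n.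
under [X in _ = _ *: X]eq_bigr => i _ do rewrite scalerBl.
rewrite sumrB scalerBr !scaler_sumr.
under eq_bigr => i _ do rewrite scalerA [_ * m.+1%:R]mulrC -scalerA !scalerBr.
rewrite sumrB addrCA; congr (_ + _).
(* The top boundary term vanishes, and the separate term with [a 0] fills the gap at the bottom of
   the shifted sum. *)
rewrite big_ord_recr /= (@bernstein_gt _ m m.+1) // !scaler0 addr0.
rewrite [X in _ = - X]big_ord_recl /= opprD scalerN; congr (- _ - _).
by rewrite scalerA [RHS]scalerA [a 0%N * _]mulrC.
Qed.

Lemma derivn_bernstein_form (R : realType) (n j : nat) (a : nat -> R) :
  (j <= n)%N ->
  derivn j (bernstein_form n a)
  = (n ^_ j)%:R *: bernstein_form (n - j) (fdiff a j).
Proof.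
elim: j => [_|j IHj ltjn].
  rewrite derivn0 ffactn0 scale1r subn0; apply: eq_bigr => k _.
  by rewrite fdiff0.
(* Writing n-j as a successor exposes the degree that drops; its factor n-j extends the falling
   factorial. *)
rewrite derivnS IHj ?(ltnW ltjn) // derivZ -(subnSK ltjn).
rewrite deriv_bernstein_form scalerA -natrM subnSK // ffactnSr.
congr (_ *: _); apply: eq_bigr => k _.
by rewrite fdiffS.
Qed.

Lemma horner_bernstein_form (R : realType) (m : nat) (a : nat -> R) (x : R) :
  (bernstein_form m a).[x] = \sum_(k < m.+1) (bernstein R m k).[x] * a k.
Proof.
by rewrite horner_sum; apply: eq_bigr => k _; rewrite hornerZ mulrC.
Qed.

Lemma horner0_bernstein_form (R : realType) (m : nat) (a : nat -> R) :
  (bernstein_form m a).[0] = a 0%N.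
Proof.
rewrite horner_bernstein_form big_ord_recl big1 => [|k _]; rewrite /bernstein.
  by rewrite addr0 bin0 scale1r !hornerE subr0 expr1n !mul1r.
by rewrite hornerZ hornerM hornerXn expr0n /= mul0r mulr0 mul0r.
Qed.

Lemma size_bernstein_form (R : realType) (m : nat) (a : nat -> R) :
  (size (bernstein_form m a) <= m.+1)%N.
Proof.
rewrite (leq_trans (size_sum _ _ _)) //; apply/bigmax_leqP => k _.
rewrite !(leq_trans (size_scale_leq _ _)) // (leq_trans (size_polyMleq _ _)) //.
rewrite size_polyXn addSn /=.
rewrite (leq_trans (leq_add (leqnn _) (size_poly_exp_leq _ _))) // addnS ltnS.
rewrite -opprB size_polyN size_XsubC mul1n subnKC // -ltnS; exact: ltn_ord.
Qed.

Lemma coef_bernstein_form (R : realType) (n j : nat) (a : nat -> R) :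
  (j <= n)%N -> (bernstein_form n a)`_j = 'C(n, j)%:R * fdiff a j 0.
Proof.
move=> lejn; have := coef_derivn j (bernstein_form n a) 0.
rewrite addn0 ffactnn derivn_bernstein_form // -horner_coef0 hornerZ.
rewrite horner0_bernstein_form -[_ *+ j`!]mulr_natr -bin_ffact natrM mulrAC.
(* Since [n ^_ j] is C(n,j) j!, both sides carry the factor j!, which is nonzero in [R]. *)
move=> coef_fact; apply: (@mulIf _ j`!%:R); last exact: esym.
by rewrite pnatr_eq0 -lt0n fact_gt0.
Qed.

(** Both sides obey the same recursion in j: the extreme nodes of an order j+1 difference lie
    (j+1)/n apart, exactly the ratio of successive factors j!/n^j inverted. The bound on j+k keeps
    every node among those where [g] is prescribed. *)
Lemma fdiff_divided_diff (R : realType) (n j k : nat) (a : nat -> R)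
    (g : R -> R) :
  (j + k <= n)%N -> (forall i, (i <= n)%N -> g (i%:R / n%:R) = a i) ->
  fdiff a j k = j`!%:R / n%:R ^+ j * divided_diff g j (nodes R n k).
Proof.
move=> + ga; elim: j k => [|j IHj] k lejk.
  by rewrite fdiff0 fact0 expr0 divr1 mul1r /= /nodes addn0 ga.
have n0 : n%:R != 0 :> R by rewrite pnatr_eq0; case: n lejk {ga IHj}.
have shift : (fun i => nodes R n k i.+1) = nodes R n k.+1.
  by apply/funext => i; rewrite /nodes addSnnS.
rewrite fdiffS !IHj ?addnS //; last exact: ltnW.
rewrite /= shift -mulrBr /nodes addn0 -mulrBl natrD addrAC subrr add0r.
rewrite factS natrM exprS; field.
by rewrite n0 nat1r pnatr_eq0 expf_neq0.
Qed.

(** Passes from the analytic derivatives of the theorem to the formal ones computed above. *)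
Lemma derive1n_horner (R : realType) (p : {poly R}) (j : nat) :
  derive1n j (horner p) = horner (derivn j p).
Proof. by elim: j => // j IHj; rewrite derive1nS IHj derivnS derivE. Qed.

Theorem theorem4p1 (R : realType) (n : nat) (rho : R) (f : R -> R)
    (Phi : {poly R})
    (hn : (1 <= n)%N) (hrho : 0 < rho)
    (hf : {within `[0, 1], continuous f})
    (hPhi_deg : (size Phi <= n.+1)%N)
    (hPhi : forall k : nat, (k <= n)%N -> Phi.[k%:R / n%:R] = F_fun n rho k f)
    (x : R) (hx : 0 <= x <= 1) :
  (derive1 (horner (U_op n rho f)) x
     = n%:R * \sum_(k < n) (bernstein R n.-1 k).[x] * fwd_diff n rho 1 k f
   /\ n%:R * \sum_(k < n) (bernstein R n.-1 k).[x] * fwd_diff n rho 1 k f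
     = \sum_(k < n) (bernstein R n.-1 k).[x]
         * divided_diff (horner Phi) 1 (nodes R n k))
  /\
  (forall j : nat, (j <= n)%N ->
     derive1n j (horner (U_op n rho f)) x
       = (n ^_ j)%:R * \sum_(k < (n - j).+1)
           (bernstein R (n - j) k).[x] * fwd_diff n rho j k f
     /\ (n ^_ j)%:R * \sum_(k < (n - j).+1)
           (bernstein R (n - j) k).[x] * fwd_diff n rho j k f
       = (n ^_ j)%:R * \sum_(k < (n - j).+1)
           (bernstein R (n - j) k).[x]
           * (j`!%:R / n%:R ^+ j * divided_diff (horner Phi) j (nodes R n k)))
  /\
  ((U_op n rho f).[x]
     = \sum_(k < n.+1) 'C(n, k)%:R * fwd_diff n rho k 0 f * x ^+ k
   /\ \sum_(k < n.+1) 'C(n, k)%:R * fwd_diff n rho k 0 f * x ^+ k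
     = \sum_(k < n.+1) 'C(n, k)%:R * (k`!%:R / n%:R ^+ k)
         * divided_diff (horner Phi) k (nodes R n 0) * x ^+ k).
Proof.
pose a k := F_fun n rho k f.
have UE : U_op n rho f = bernstein_form n a by [].
have deltaE j k : fwd_diff n rho j k f = fdiff a j k by [].
have ddE j k : (j + k <= n)%N -> fwd_diff n rho j k f
    = j`!%:R / n%:R ^+ j * divided_diff (horner Phi) j (nodes R n k).
  by move=> lejk; rewrite deltaE (fdiff_divided_diff lejk hPhi).
have derivU j : (j <= n)%N -> derive1n j (horner (U_op n rho f)) x
    = (n ^_ j)%:R * \sum_(k < (n - j).+1)
        (bernstein R (n - j) k).[x] * fwd_diff n rho j k f.
  move=> lejn; rewrite derive1n_horner UE derivn_bernstein_form // hornerZ.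
  by rewrite horner_bernstein_form.
split; [split|split; [move=> j lejn; split|split]].
- have := derivU 1%N hn.
  by rewrite ffactn1 subn1 prednK.
- rewrite mulr_sumr; apply: eq_bigr => k _.
  have n0 : n%:R != 0 :> R by rewrite pnatr_eq0 -lt0n.
  (* For j = 1 the rescaling factor is 1/n, which cancels the prefactor n. *)
  by rewrite ddE ?add1n // (_ : 1`! = 1)%N // mul1r expr1 mulrCA mulVKf.
- exact: derivU.
- congr (_ * _); apply: eq_bigr => k _; rewrite ddE //.
  by have := ltn_ord k; rewrite ltnS leq_subRL.
(* The degree bound lets the monomial expansion run up to n even if the leading coefficients
   vanish. *)
- rewrite UE (horner_coef_wide _ (size_bernstein_form n a)).
  by apply: eq_bigr => k _; rewrite coef_bernstein_form // -ltnS.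
- apply: eq_bigr => k _; rewrite ddE ?mulrA // addn0.
  by rewrite -ltnS.
Qed.
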